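(* Let $f:X\to Y$ be an abstract simplicial map between simplicial complexes $X$ and $Y$. Then the discrete exterior derivative commutes with pullback along $f$: for every $k\ge 0$ and every $\alpha\in C^k(Y)$, $$f^*(d\alpha)=d(f^*\alpha)\quad\text{in } C^{k+1}(X).$$ Equivalently, $\langle f^*d\alpha,[u_0,\ldots,u_{k+1}]\rangle=\langle d f^*\alpha,[u_0,\ldots,u_{k+1}]\rangle$ for all oriented $(k+1)$-simplices $[u_0,\ldots,u_{k+1}]$ of $X$.
   Context: Chains and cochains: $C_k(X)$ is the real vector space of simplicial $k$-chains of $X$, generated by oriented $k$-simplices $[v_0,\ldots,v_k]$, with $[v_{\pi(0)},\ldots,v_{\pi(k)}]=\operatorname{sgn}(\pi)[v_0,\ldots,v_k]$. $C^k(X)$ is the dual space of $k$-cochains, and $\langle\alpha,c\rangle=\alpha(c)$ is evaluation of a cochain on a chain. Discrete exterior derivative: for $\alpha\in C^k(X)$, $d\alpha\in C^{k+1}(X)$ is defined by $\langle d\alpha,\sigma\rangle=\langle\alpha,\partial\sigma\rangle$ on $(k+1)$-simplices $\sigma$, extended linearly, where $\partial[v_0,\ldots,v_{k+1}]=\sum_{i=0}^{k+1}(-1)^i[v_0,\ldots,\widehat{v_i},\ldots,v_{k+1}]$. Abstract simplicial map: $f:X\to Y$ is given by a map on vertex sets such that whenever $\{u_0,\ldots,u_k\}$ spans a simplex in $X$, the set $\{f(u_0),\ldots,f(u_k)\}$ spans a simplex in $Y$ (the images need not be distinct). Induced map on chains: $f_\sharp:C_k(X)\to C_k(Y)$ is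 the linear map with $f_\sharp([u_0,\ldots,u_k])=[f(u_0),\ldots,f(u_k)]$ if $f(u_0),\ldots,f(u_k)$ are distinct, and $f_\sharp([u_0,\ldots,u_k])=0$ otherwise. Pullback: for $\alpha\in C^k(Y)$, $f^*\alpha\in C^k(X)$ is defined by $f^*\alpha(c)=\alpha(f_\sharp(c))$ for all $c\in C_k(X)$. *)

(* Defs.v *)
From HB Require Import structures.
From mathcomp Require Import all_boot all_order all_fingroup all_algebra.
From mathcomp Require Import generic_quotient ring_quotient finmap boolp.
From mathcomp.multinomials Require Import monalg.

Set Implicit Arguments.
Unset Strict Implicit.
Unset Printing Implicit Defensive.

Import GRing.Theory.

Local Open Scope fset_scope.
Local Open Scope ring_scope.
Local Open Scope quotient_scope.

(* Abstract simplicial complexes, possibly infinite.  V is exactly the vertex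
   set: every v : V spans a 0-simplex. *)
Record complex (V : choiceType) := Complex {
  simplex : {pred {fset V}};
  simplex_neq0 : fset0 \notin simplex;
  simplex_vertex : forall v : V, [fset v] \in simplex;
  simplex_sub : forall s t : {fset V},
    s \in simplex -> t `<=` s -> t != fset0 -> t \in simplex }.

Record simplicial_map (V W : choiceType) (X : complex V) (Y : complex W) :=
  SimplicialMap {
    vertex_map :> V -> W;
    vertex_mapP : forall s : {fset V},
      s \in simplex X -> [fset vertex_map u | u in s] \in simplex Y }.

Section OrderedSimplices.
Variables (V : choiceType) (X : complex V).

Definition vset (k : nat) (v : {ffun 'I_k -> V}) : {fset V} :=
  [fset v i | i in 'I_k].

(* (v_0, ..., v_k) with distinct entries spanning a simplex of X.  The oriented
   simplex [v_0, ..., v_k] is its class in the chain space, see [osimp]. *)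
Definition is_osimplex k (v : {ffun 'I_k.+1 -> V}) :=
  injectiveb v && (vset v \in simplex X).

Definition osimplex k := {v : {ffun 'I_k.+1 -> V} | is_osimplex v}.

Lemma osimplex_inj k (v : osimplex k) : injective (val v).
Proof. by case/andP: (valP v) => /injectiveP. Qed.

Lemma osimplex_comp_subproof k m (v : osimplex k) (h : 'I_m.+1 -> 'I_k.+1) :
  injective h -> is_osimplex [ffun i => val v (h i)].
Proof.
move=> hI; apply/andP; split.
  by apply/injectiveP => i j; rewrite !ffunE => /osimplex_inj /hI.
case/andP: (valP v) => _ vX; apply: simplex_sub vX _ _.
  apply/fsubsetP => x /imfsetP[i _ ->]; rewrite ffunE.
  exact: in_imfset.
by apply/fset0Pn; exists (val v (h ord0)); apply/imfsetP; exists ord0; rewrite ?ffunE.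
Qed.

Definition osimplex_comp k m (v : osimplex k) (h : 'I_m.+1 -> 'I_k.+1)
    (hI : injective h) : osimplex m :=
  exist (fun w => is_osimplex w) _
    (osimplex_comp_subproof v hI).

Definition osimplex_perm k (v : osimplex k) (s : 'S_k.+1) : osimplex k :=
  osimplex_comp v (@perm_inj _ s).

(* (v_0, ..., v_{i-1}, v_{i+1}, ..., v_{k+1}) *)
Definition osimplex_face k (v : osimplex k.+1) (i : 'I_k.+2) : osimplex k :=
  osimplex_comp v (@lift_inj _ i).

End OrderedSimplices.

(* The constructions on chains are locked: conversion must not unfold them down
   to finitely supported functions. *)
Fact chain_key : unit. Proof. exact: tt. Qed.

Section Chains.
Variables (R : comNzRingType) (V : choiceType) (X : complex V) (k : nat).

Local Notation free := {malg R[osimplex X k]}.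

Definition simp_gen : osimplex X k -> free :=
  locked_with chain_key (fun v => << 1 *g v >>).

Definition orient_gen (v : osimplex X k) (s : 'S_k.+1) : free :=
  simp_gen (osimplex_perm v s) - (-1) ^+ s *: simp_gen v.

(* The submodule spanned by all the [orient_gen v s]. *)
Definition orient_rel : {pred free} := fun c =>
  `[< exists r : seq (R * (osimplex X k * 'S_k.+1)),
        c = \sum_(t <- r) t.1 *: orient_gen t.2.1 t.2.2 >].

Lemma orient_relP c :
  reflect (exists r : seq (R * (osimplex X k * 'S_k.+1)),
             c = \sum_(t <- r) t.1 *: orient_gen t.2.1 t.2.2)
          (c \in orient_rel).
Proof. exact: asboolP. Qed.

Lemma orient_relZ a c : c \in orient_rel -> a *: c \in orient_rel.
Proof.
case/orient_relP => r ->; apply/orient_relP.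
exists [seq (a * t.1, t.2) | t <- r]; rewrite big_map scaler_sumr.
by apply: eq_bigr => t _; rewrite scalerA.
Qed.

Lemma orient_rel_zmod_closed : zmod_closed orient_rel.
Proof.
split=> [|x y xR yR]; first by apply/orient_relP; exists [::]; rewrite big_nil.
have /orient_relP[r2 e2] : - y \in orient_rel by rewrite -scaleN1r orient_relZ.
case/orient_relP: xR => r1 ->; rewrite e2.
by apply/orient_relP; exists (r1 ++ r2); rewrite big_cat.
Qed.

HB.instance Definition _ :=
  GRing.isZmodClosed.Build free orient_rel orient_rel_zmod_closed.

(* C_k(X): the free module on ordered simplices modulo
   (v_{s 0}, ..., v_{s k}) = sgn(s) (v_0, ..., v_k). *)
Definition chain : Type := Quotient.quot orient_rel.
HB.instance Definition _ := GRing.Zmodule.on chain.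

Definition to_chain : free -> chain :=
  locked_with chain_key (fun c => \pi_(Quotient.quot orient_rel) c).

Lemma to_chainE c : to_chain c = \pi_(Quotient.quot orient_rel) c.
Proof. by rewrite /to_chain unlock. Qed.

Definition of_chain (c : chain) : free := repr (c : Quotient.quot orient_rel).

Lemma of_chainK : cancel of_chain to_chain.
Proof. by move=> c; rewrite to_chainE /of_chain reprK. Qed.

Lemma to_chain_is_zmod_morphism : zmod_morphism to_chain.
Proof.
by move=> x y; rewrite !to_chainE; exact: (raddfB (\pi_(Quotient.quot orient_rel))).
Qed.

Lemma to_chain_eq x y : to_chain x = to_chain y <-> x - y \in orient_rel.
Proof.
rewrite !to_chainE (Quotient.idealrBE orient_rel).
by split=> [e | /eqP //]; apply/eqP.
Qed.

Definition chain_scale : R -> chain -> chain :=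
  locked_with chain_key (fun a c => to_chain (a *: of_chain c)).

Lemma to_chainZ a x : to_chain (a *: x) = chain_scale a (to_chain x).
Proof.
rewrite /chain_scale unlock; apply/to_chain_eq; rewrite -scalerBr orient_relZ //.
by apply/to_chain_eq; rewrite of_chainK.
Qed.

Lemma to_chain_surj c : exists x, c = to_chain x.
Proof. by exists (of_chain c); rewrite of_chainK. Qed.

Lemma chain_scaleA a b c : chain_scale a (chain_scale b c) = chain_scale (a * b) c.
Proof. by case: (to_chain_surj c) => x ->; rewrite -!to_chainZ scalerA. Qed.

Lemma chain_scale1 : left_id 1 chain_scale.
Proof. by move=> c; case: (to_chain_surj c) => x ->; rewrite -to_chainZ scale1r. Qed.

HB.instance Definition _ :=
  GRing.isZmodMorphism.Build free chain to_chain to_chain_is_zmod_morphism.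

Lemma chain_scaleDr : right_distributive chain_scale +%R.
Proof.
move=> a c d; case: (to_chain_surj c) => x ->; case: (to_chain_surj d) => y ->.
by rewrite -raddfD -!to_chainZ scalerDr raddfD.
Qed.

Lemma chain_scaleDl c : {morph chain_scale^~ c : a b / a + b}.
Proof.
move=> a b; case: (to_chain_surj c) => x -> /=.
by rewrite -!to_chainZ scalerDl raddfD.
Qed.

HB.instance Definition _ := GRing.Zmodule_isLmodule.Build R chain
  chain_scaleA chain_scale1 chain_scaleDr chain_scaleDl.
HB.instance Definition _ :=
  GRing.isScalable.Build R free chain *:%R to_chain to_chainZ.

(* The oriented simplex [v_0, ..., v_k]. *)
Definition osimp (v : osimplex X k) : chain := to_chain (simp_gen v).

Lemma osimp_perm v s : osimp (osimplex_perm v s) = (-1) ^+ s *: osimp v.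
Proof.
rewrite /osimp -linearZ; apply/to_chain_eq/orient_relP.
by exists [:: (1, (v, s))]; rewrite big_seq1 scale1r.
Qed.

Lemma chain_span c :
  exists r : seq (R * osimplex X k), c = \sum_(t <- r) t.1 *: osimp t.2.
Proof.
case: (to_chain_surj c) => x ->; exists [seq (x@_v, v) | v <- msupp x].
rewrite big_map [in LHS](monalgE x) raddf_sum; apply: eq_bigr => v _ /=.
rewrite /osimp -linearZ; congr (to_chain _); apply/malgP => w.
by rewrite [RHS]mcoeffZ [LHS]mcoeffU /simp_gen unlock [in RHS]mcoeffU mulrnAr mulr1.
Qed.

(* C^k(X): the dual of C_k(X). *)
Definition cochain : Type := {scalar chain}.

Lemma cochainP (a b : cochain) : a =1 b -> a = b.
Proof.
case: a b => [a [[a1] [a2]]] [b [[b1] [b2]]] /= /funext e.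
by subst b; rewrite (Prop_irrelevance a1 b1) (Prop_irrelevance a2 b2).
Qed.

End Chains.

Section Extension.
Variables (R : comNzRingType) (V : choiceType) (X : complex V) (k : nat).
Variable L : lmodType R.
Variable g : osimplex X k -> L.

Local Notation free := {malg R[osimplex X k]}.

Definition free_lift : free -> L :=
  locked_with chain_key (fun c => \sum_(v <- msupp c) c@_v *: g v).

Lemma free_liftE (d : {fset osimplex X k}) (c : free) : msupp c `<=` d ->
  free_lift c = \sum_(v <- d) c@_v *: g v.
Proof.
move=> cd; rewrite /free_lift unlock (big_fset_incl _ cd) // => v _ vc.
by rewrite mcoeff_outdom // scale0r.
Qed.

Lemma free_lift_is_linear : linear free_lift.
Proof.
move=> a x y; pose d := msupp x `|` (msupp y `|` msupp (a *: x + y)).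
have [xd yd cd] : [/\ msupp x `<=` d, msupp y `<=` d & msupp (a *: x + y) `<=` d].
  by split; apply/fsubsetP => v vx; rewrite !inE vx ?orbT.
rewrite !(@free_liftE d) // scaler_sumr -big_split; apply: eq_bigr => v _ /=.
by rewrite mcoeffD mcoeffZ scalerDl scalerA.
Qed.

HB.instance Definition _ :=
  GRing.isLinear.Build R free L *:%R free_lift free_lift_is_linear.

Lemma free_liftU v : free_lift (simp_gen R v) = g v.
Proof.
by rewrite /simp_gen unlock (free_liftE (msuppU_le)) big_seq_fset1 mcoeffUU scale1r.
Qed.

Definition alternating :=
  forall v (s : 'S_k.+1), g (osimplex_perm v s) = (-1) ^+ s *: g v.

(* The linear map C_k(X) -> L sending [v_0, ..., v_k] to g v; linear maps out of
   C_k(X) are specified through [chain_lift_osimp]. *)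
Definition chain_lift (gP : alternating) (c : chain R X k) : L :=
  free_lift (of_chain c).

Variable gP : alternating.

Lemma free_lift_orient_gen v s : free_lift (orient_gen R v s) = 0.
Proof.
rewrite /orient_gen -scaleNr addrC free_lift_is_linear.
by rewrite !free_liftU gP scaleNr addNr.
Qed.

Lemma chain_lift_to_chain x : chain_lift gP (to_chain x) = free_lift x.
Proof.
apply/eqP; rewrite -subr_eq0 /chain_lift -(linearB free_lift) /=.
have /orient_relP[r ->] : of_chain (to_chain x) - x \in @orient_rel R V X k.
  by apply/to_chain_eq; rewrite of_chainK.
rewrite linear_sum big1 //= => t _.
by rewrite linearZ_LR /= free_lift_orient_gen scaler0.
Qed.

Lemma chain_lift_is_linear : linear (chain_lift gP).
Proof.
move=> a c d; case: (to_chain_surj c) => x ->; case: (to_chain_surj d) => y ->.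
by rewrite -linearP !chain_lift_to_chain linearP.
Qed.

HB.instance Definition _ := GRing.isLinear.Build R (chain R X k) L *:%R
  (chain_lift gP) chain_lift_is_linear.

Lemma chain_lift_osimp v : chain_lift gP (osimp R v) = g v.
Proof. by rewrite /osimp chain_lift_to_chain free_liftU. Qed.

End Extension.

Section Boundary.
Variables (R : comNzRingType) (V : choiceType) (X : complex V) (k : nat).

Definition boundary_gen (v : osimplex X k.+1) : chain R X k :=
  \sum_(i < k.+2) (-1) ^+ i *: osimp R (osimplex_face v i).

Lemma boundary_gen_alternating : alternating boundary_gen.
Proof.
move=> v s; rewrite /boundary_gen scaler_sumr [RHS](reindex_inj (@perm_inj _ s)).
apply: eq_bigr => i _ /=.
pose h j := odflt j (unlift (s i) (s (lift i j))).
have hK j : lift (s i) (h j) = s (lift i j).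
  rewrite /h; have := neq_lift i j.
  by rewrite -(inj_eq (@perm_inj _ s)) => /unlift_some[? ? ->].
have hI : injective h.
  by move=> j1 j2 e; apply/(@lift_inj _ i)/(@perm_inj _ s); rewrite -!hK e.
have def_s : s = lift_perm i (s i) (perm hI).
  apply/permP => j; case: (unliftP i j) => [j'|] ->; last by rewrite lift_perm_id.
  by rewrite lift_perm_lift permE hK.
have -> : osimplex_face (osimplex_perm v s) i
        = osimplex_perm (osimplex_face v (s i)) (perm hI).
  by apply/val_inj/ffunP => j; rewrite !ffunE permE hK.
have sgn_s : odd_perm s = odd i (+) odd (s i) (+) odd_perm (perm hI).
  by rewrite {1}def_s odd_lift_perm.
rewrite osimp_perm 2!scalerA; congr (_ *: _); rewrite sgn_s !signr_addb.
rewrite (signr_odd _ i) (signr_odd _ (s i)) [RHS]mulrAC.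
by rewrite -(mulrA _ ((-1) ^+ s i) ((-1) ^+ s i)) -expr2 sqrr_sign mulr1.
Qed.

Definition boundary : chain R X k.+1 -> chain R X k :=
  chain_lift boundary_gen_alternating.
HB.instance Definition _ := GRing.Linear.on boundary.

Lemma boundary_osimp v :
  boundary (osimp R v) = \sum_(i < k.+2) (-1) ^+ i *: osimp R (osimplex_face v i).
Proof. exact: chain_lift_osimp. Qed.

(* <d alpha, c> = <alpha, boundary c> *)
Definition ext_deriv (alpha : cochain R X k) : cochain R X k.+1 :=
  alpha \o boundary.

End Boundary.

Section Functoriality.
Variables (R : comNzRingType) (V W : choiceType) (X : complex V) (Y : complex W).
Variables (f : simplicial_map X Y) (k : nat).

Definition map_tuple (v : osimplex X k) : {ffun 'I_k.+1 -> W} :=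
  [ffun i => f (val v i)].

Lemma vset_map_tuple v : vset (map_tuple v) \in simplex Y.
Proof.
have -> : vset (map_tuple v) = [fset f u | u in vset (val v)].
  apply/fsetP => y; apply/imfsetP/imfsetP => [[i _ ->]|[_ /imfsetP[i _ ->] ->]].
    by exists (val v i); rewrite ?ffunE //; apply: in_imfset.
  by exists i; rewrite ?ffunE.
by apply: vertex_mapP; case/andP: (valP v).
Qed.

Lemma is_osimplex_map_tuple v :
  is_osimplex Y (map_tuple v) = injectiveb (map_tuple v).
Proof. by rewrite /is_osimplex vset_map_tuple andbT. Qed.

(* The image of an ordered simplex always spans a simplex of Y, so by
   [is_osimplex_map_tuple] the second branch is exactly the case where the f(v_i)
   are not distinct. *)
Definition chain_map_gen (v : osimplex X k) : chain R Y k :=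
  if insub (map_tuple v) is Some w then osimp R (w : osimplex Y k) else 0.

Lemma chain_map_gen_inj v (w : osimplex Y k) :
  val w = map_tuple v -> chain_map_gen v = osimp R w.
Proof. by rewrite /chain_map_gen => <-; rewrite valK. Qed.

Lemma chain_map_gen_ninj v : ~~ injectiveb (map_tuple v) -> chain_map_gen v = 0.
Proof.
by rewrite -is_osimplex_map_tuple /chain_map_gen => vN; rewrite insubN.
Qed.

Lemma chain_map_gen_alternating : alternating chain_map_gen.
Proof.
move=> v s.
have e : map_tuple (osimplex_perm v s) = [ffun i => map_tuple v (s i)].
  by apply/ffunP => i; rewrite !ffunE.
have [fvI|fvNI] := boolP (injectiveb (map_tuple v)).
  have wP : is_osimplex Y (map_tuple v) by rewrite is_osimplex_map_tuple.
  pose w : osimplex Y k := exist (fun w => is_osimplex Y w) _ wP.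
  rewrite (@chain_map_gen_inj _ (osimplex_perm w s)); last by rewrite e.
  by rewrite (@chain_map_gen_inj v w) // osimp_perm.
rewrite !chain_map_gen_ninj ?scaler0 //; apply: contra fvNI => /injectiveP sI.
apply/injectiveP => i j eij; apply: (@perm_inj _ s^-1%g); apply: sI.
by rewrite e [LHS]ffunE [RHS]ffunE !permKV.
Qed.

Definition chain_map : chain R X k -> chain R Y k :=
  chain_lift chain_map_gen_alternating.
HB.instance Definition _ := GRing.Linear.on chain_map.

Lemma chain_map_osimp_inj (v : osimplex X k) (w : osimplex Y k) :
  val w = [ffun i => f (val v i)] -> chain_map (osimp R v) = osimp R w.
Proof. by move=> e; rewrite /chain_map chain_lift_osimp; apply: chain_map_gen_inj. Qed.

Lemma chain_map_osimp_ninj (v : osimplex X k) :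
  ~~ injectiveb [ffun i => f (val v i)] -> chain_map (osimp R v) = 0.
Proof. by move=> e; rewrite /chain_map chain_lift_osimp; apply: chain_map_gen_ninj. Qed.

Definition pullback (alpha : cochain R Y k) : cochain R X k :=
  alpha \o chain_map.

End Functoriality.

(* Main.v *)
(* The chain map f_# commutes with the boundary, so evaluating alpha gives the
   theorem.  On an oriented simplex [v_0, ..., v_{k+1}] with distinct images
   this holds face by face.  If f v_a = f v_b with a <> b, only the faces
   omitting v_a or v_b can have a nonzero image; these two images differ by the
   permutation that the transposition (a b) induces on the remaining positions,
   and its sign makes the two terms cancel. *)
Require Import Defs.
From mathcomp Require Import all_boot all_algebra reals.
From mathcomp Require Import all_fingroup.

Import GRing.Theory.

Local Open Scope ring_scope.

(** Writing [s] through [lift_perm] lets [odd_lift_perm] relate its sign to that of the permutation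
    left after deleting [i] and [s i]. *)
Lemma perm_lift_decomposition n (s : 'S_n.+1) (i : 'I_n.+1) :
  {p : 'S_n | s = lift_perm i (s i) p}.
Proof.
(* The default [j] is never reached: [lift i j] differs from [i], so [s (lift i j)] differs from
   [s i]. *)
pose h j := odflt j (unlift (s i) (s (lift i j))).
have hK j : lift (s i) (h j) = s (lift i j).
  rewrite /h; have := neq_lift i j.
  by rewrite -(inj_eq (@perm_inj _ s)) => /unlift_some[? ? ->].
have hI : injective h.
  by move=> j1 j2 e; apply/(@lift_inj _ i)/(@perm_inj _ s); rewrite -!hK e.
exists (perm hI); apply/permP => j.
case: (unliftP i j) => [j'|] ->; last by rewrite lift_perm_id.
by rewrite lift_perm_lift permE hK.
Qed.

Section ChainMapBoundary.
Variables (R : comNzRingType) (V W : choiceType) (X : complex V) (Y : complex W).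
Variable f : simplicial_map X Y.

(** Covers degenerate images too, so the cancellation below needs no case split. *)
Lemma chain_map_osimp_eq k (v w : osimplex X k) :
  Defs.map_tuple f v = Defs.map_tuple f w ->
  chain_map f (osimp R v) = chain_map f (osimp R w).
Proof. by rewrite /chain_map !chain_lift_osimp /chain_map_gen => ->. Qed.

Lemma chain_map_face_cancel k (v : osimplex X k.+1) (a b : 'I_k.+2) :
  a != b -> f (val v a) = f (val v b) ->
  (-1) ^+ a *: chain_map f (osimp R (osimplex_face v a)) =
  - ((-1) ^+ b *: chain_map f (osimp R (osimplex_face v b))).
Proof.
move=> ab fab; have [p] := perm_lift_decomposition _ (tperm a b) a.
rewrite tpermL => def_s.
(* Entry [j] is [lift a j] on one side and its swap under [tperm a b] on the other; [f] does not see
   the swap, by [fab]. *)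
rewrite (chain_map_osimp_eq _ _ (osimplex_perm (osimplex_face v b) p)); last first.
  apply/ffunP => j; rewrite !ffunE.
  have -> : lift b (p j) = tperm a b (lift a j) by rewrite def_s lift_perm_lift.
  by case: tpermP => [->|->|].
rewrite osimp_perm [chain_map f (_ *: _)]linearZ_LR scalerA -scaleNr.
congr (_ *: _).
(* A transposition is odd, so [a], [b] and [p] have odd total parity, which is the required sign
   identity. *)
have : odd_perm (tperm a b) by rewrite odd_tperm.
rewrite {1}def_s odd_lift_perm -(signr_odd _ a) -(signr_odd _ b).
by case: (odd a) (odd b) (odd_perm p) => [] [] [] //= _;
  rewrite ?expr0 ?expr1 ?mulrN ?mulNr ?mulr1 ?opprK.
Qed.

Lemma chain_map_boundary_osimp k (v : osimplex X k.+1) :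
  chain_map f (boundary (osimp R v)) = boundary (chain_map f (osimp R v)).
Proof.
rewrite boundary_osimp linear_sum /=.
under eq_bigr do rewrite [chain_map f (_ *: _)]linearZ_LR.
have [fvI|fvNI] := boolP (injectiveb (Defs.map_tuple f v)).
  have wP : is_osimplex Y (Defs.map_tuple f v) by rewrite is_osimplex_map_tuple.
  pose w : osimplex Y k.+1 := exist (fun w => is_osimplex Y w) _ wP.
  rewrite (@chain_map_osimp_inj _ _ _ _ _ f _ v w) // boundary_osimp.
  apply: eq_bigr => i _; congr (_ *: _); apply: chain_map_osimp_inj.
  by apply/ffunP => j; rewrite !ffunE.
rewrite chain_map_osimp_ninj // linear0.
have [a [b [ab fab]]] : exists a b, a != b /\ f (val v a) = f (val v b).
  case/injectivePn: fvNI => a [b ab]; rewrite !ffunE => fab.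
  by exists a, b.
rewrite (bigD1 a) //= (bigD1 b) 1?eq_sym //= big1 ?addr0.
  by rewrite (chain_map_face_cancel _ _ _ _ ab fab) addNr.
move=> i /andP[ia ib]; rewrite chain_map_osimp_ninj ?scaler0 //.
(* The face omitting [i] keeps both [v_a] and [v_b], now at positions [a'] and [b'], so its image is
   still degenerate. *)
have [a' def_a _] := unlift_some ia; have [b' def_b _] := unlift_some ib.
apply/injectivePn; exists a', b'; last by rewrite !ffunE /= -def_a -def_b.
by apply: contraNneq ab => e; rewrite def_a def_b e.
Qed.

Lemma chain_map_boundary k (c : chain R X k.+1) :
  chain_map f (boundary c) = boundary (chain_map f c).
Proof.
have [r ->] := chain_span c; rewrite !linear_sum /=; apply: eq_bigr => t _.
rewrite [boundary (_ *: _)]linearZ_LR [chain_map f (_ *: osimp _ _)]linearZ_LR.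
rewrite [LHS]linearZ_LR [RHS]linearZ_LR; congr (_ *: _).
exact: chain_map_boundary_osimp.
Qed.

Lemma pullback_ext_deriv k (alpha : cochain R Y k) :
  pullback f (ext_deriv alpha) = ext_deriv (pullback f alpha).
Proof. by apply: cochainP => c /=; rewrite chain_map_boundary. Qed.

End ChainMapBoundary.

Theorem proposition3p7 (R : realType) (V W : choiceType)
    (X : complex V) (Y : complex W) (f : simplicial_map X Y)
    (k : nat) (alpha : cochain R Y k) :
  pullback f (ext_deriv alpha) = ext_deriv (pullback f alpha) /\
  (forall u : osimplex X k.+1,
     pullback f (ext_deriv alpha) (osimp R u) =
     ext_deriv (pullback f alpha) (osimp R u)).
Proof. by rewrite pullback_ext_deriv. Qed.
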